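(* Let $\mathfrak{G}=\{(G_\omega,\circ_\omega)\}_{\omega\in\Omega}$ be a set of distinct S-groupoids with a corresponding set $\mathfrak{H}=\{(H_\omega,\circ_\omega)\}_{\omega\in\Omega}$ of S-subsemigroups (so that $(H_\omega,\circ_\omega)$ is an S-subsemigroup of $(G_\omega,\circ_\omega)$ for each $\omega\in\Omega$). Define a relation $\sim$ on $\mathfrak{G}$ by: for all $\omega_i,\omega_j\in\Omega$, $(G_{\omega_i},\circ_{\omega_i})\sim(G_{\omega_j},\circ_{\omega_j})$ if and only if $(G_{\omega_i},\circ_{\omega_i})$ and $(G_{\omega_j},\circ_{\omega_j})$ are S-isotopic (with respect to the S-subsemigroups $H_{\omega_i}$ and $H_{\omega_j}$). Then $\sim$ is an equivalence relation on $\mathfrak{G}$.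
   Context: A groupoid $(L,\cdot)$ is a non-empty set $L$ with a binary operation $\cdot: L\times L\to L$. An S-groupoid (Smarandache groupoid) is a groupoid $(L,\cdot)$ having at least one non-trivial subset $M\subset L$ (a proper subset with more than one element) such that $(M,\cdot)$ is a subsemigroup, i.e. closed and associative under $\cdot$; such an $M$ is called an S-subsemigroup of $L$. Maps are written on the right of their arguments. An isotopism $(U,V,W):(L,\cdot)\to(G,\circ)$ of groupoids is a triple of bijections $U,V,W:L\to G$ with $xU\circ yV=(x\cdot y)W$ for all $x,y\in L$. If $(L,\cdot)$ and $(G,\circ)$ are S-groupoids with S-subsemigroups $L'$ and $G'$ respectively, an isotopism $(U,V,W):(L,\cdot)\to(G,\circ)$ is an S-isotopism (with respect to $L',G'$) if $(L')A=G'$ for every $A\in\{U,V,W\}$. The two S-groupoids are S-isotopic (with respect to $L',G'$) if such an S-isotopism exists. *)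

(* Defs.v *)
From mathcomp Require Import all_boot.
From mathcomp Require Import classical_sets.
From Corelib Require Export RelationClasses.

Set Implicit Arguments.
Unset Strict Implicit.
Unset Printing Implicit Defensive.

Local Open Scope classical_set_scope.
Local Open Scope group_scope.

(* [magmaType] is a bare type with a binary operation [*%g]; it may be empty. *)
Definition groupoid (L : magmaType) : Prop := inhabited L.

Definition S_subsemigroup (L : magmaType) (M : set L) : Prop :=
  [/\ M `<` [set: L],
      exists x y : L, [/\ M x, M y & x <> y],
      forall x y : L, M x -> M y -> M (x * y) &
      forall x y z : L, M x -> M y -> M z -> (x * y) * z = x * (y * z)].

Definition S_groupoid (L : magmaType) : Prop :=
  groupoid L /\ exists M : set L, S_subsemigroup M.

Definition isotopism (L G : magmaType) (U V W : L -> G) : Prop :=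
  [/\ bijective U, bijective V, bijective W &
      forall x y : L, U x * V y = W (x * y)].

Definition S_isotopism (L G : magmaType) (L' : set L) (G' : set G)
    (U V W : L -> G) : Prop :=
  isotopism U V W /\ [/\ U @` L' = G', V @` L' = G' & W @` L' = G'].

Definition S_isotopic (L G : magmaType) (L' : set L) (G' : set G) : Prop :=
  exists U V W : L -> G, S_isotopism L' G' U V W.

Definition family_set (Omega : Type) (G : Omega -> magmaType) : Type :=
  {X : magmaType | exists i : Omega, X = G i}.

Definition member (Omega : Type) (G : Omega -> magmaType) (i : Omega) :
    family_set G :=
  exist _ (G i) (ex_intro _ i erefl).

(* For pairwise distinct magmas, S-isotopy with respect to the indexed
   subsets is a well-defined relation on the set of members. *)
Lemma S_isotopy_relation_exists (Omega : Type) (G : Omega -> magmaType)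
    (H : forall w : Omega, set (G w)) (Ginj : injective G) :
  exists sim : family_set G -> family_set G -> Prop,
    forall i j : Omega,
      sim (member G i) (member G j) <-> S_isotopic (H i) (H j).
Proof.
exists (fun X Y => exists i j : Omega,
  [/\ sval X = G i, sval Y = G j & S_isotopic (H i) (H j)]) => i j.
split; last by move=> Hij; exists i, j.
by case=> i' [j' [/= /Ginj <- /Ginj <-]].
Qed.

(* Main.v *)
Require Import Defs.
From mathcomp Require Import all_boot.
From mathcomp Require Import classical_sets.

(** Isotopisms form a groupoid in the categorical sense: the triple of
    identities is one, componentwise inverses of an isotopism form one, and
    so do componentwise composites.  The requirement that each component
    carry the chosen subset onto the chosen subset survives the same three
    operations, because taking direct images is functorial.  Hence
    S-isotopy is reflexive, symmetric and transitive as a relation between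
    magmas with a chosen subset ([S_isotopic_refl], [S_isotopic_sym],
    [S_isotopic_trans]), and these three properties pass to [sim] because
    every element of the family is some [member G i]. *)

Local Open Scope classical_set_scope.

Lemma image_cancel_eq (T1 T2 : Type) (f : T1 -> T2) (g : T2 -> T1)
    (A : set T1) (B : set T2) :
  cancel f g -> f @` A = B -> g @` B = A.
Proof.
by move=> fK <-; rewrite image_comp -[RHS]image_id; apply: eq_imagel => x _ /=.
Qed.

Lemma isotopism_id (L : magmaType) : isotopism (@id L) (@id L) (@id L).
Proof. by split=> //; exists id. Qed.

(** Applying [W] to a product of preimages [U' a * V' b] yields [a * b], so
    cancelling [W] turns the isotopism law of [(U, V, W)] into that of the
    inverses. *)
Lemma isotopism_inv (L G : magmaType) (U V W : L -> G) (U' V' W' : G -> L) :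
  cancel U U' -> cancel U' U -> cancel V V' -> cancel V' V ->
  cancel W W' -> cancel W' W ->
  isotopism U V W -> isotopism U' V' W'.
Proof.
move=> UK U'K VK V'K WK W'K [_ _ _ UVW].
split; [by exists U | by exists V | by exists W | move=> a b].
by rewrite -[LHS]WK -UVW U'K V'K.
Qed.

Lemma isotopism_comp (L G K : magmaType) (U V W : L -> G) (U' V' W' : G -> K) :
  isotopism U V W -> isotopism U' V' W' ->
  isotopism (U' \o U) (V' \o V) (W' \o W).
Proof.
move=> [bU bV bW UVW] [bU' bV' bW' UVW'].
by split; [exact: bij_comp.. | move=> x y /=; rewrite UVW' UVW].
Qed.

Lemma S_isotopic_refl (L : magmaType) (A : set L) : S_isotopic A A.
Proof.
by exists id, id, id; split; [exact: isotopism_id | rewrite image_id].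
Qed.

Lemma S_isotopic_sym (L G : magmaType) (A : set L) (B : set G) :
  S_isotopic A B -> S_isotopic B A.
Proof.
move=> [U [V [W [iso [UA VA WA]]]]].
have [[U' UK U'K] [V' VK V'K] [W' WK W'K] _] := iso.
exists U', V', W'; split; last by split; apply: image_cancel_eq; eassumption.
exact: (isotopism_inv _ _ _ _ _ _ _ _ UK U'K VK V'K WK W'K iso).
Qed.

Lemma S_isotopic_trans (L G K : magmaType)
    (A : set L) (B : set G) (C : set K) :
  S_isotopic A B -> S_isotopic B C -> S_isotopic A C.
Proof.
move=> [U [V [W [iso [UA VA WA]]]]] [U' [V' [W' [iso' [UB VB WB]]]]].
exists (U' \o U), (V' \o V), (W' \o W).
split; first exact: isotopism_comp.
by split; rewrite -image_comp (UA, VA, WA).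
Qed.

(** Substituting along the index equation turns the magma into [G i] and its
    membership proof into the canonical one of [member G i] at once. *)
Lemma family_set_memberP (Omega : Type) (G : Omega -> magmaType)
    (X : family_set G) : exists i, X = member G i.
Proof. by case: X => X [i Xi]; subst X; exists i. Qed.

Theorem theorem3p1 (Omega : Type) (G : Omega -> magmaType)
    (H : forall w : Omega, set (G w))
    (G_distinct : injective G)
    (G_S_groupoid : forall w : Omega, S_groupoid (G w))
    (H_S_subsemigroup : forall w : Omega, S_subsemigroup (H w))
    (sim : family_set G -> family_set G -> Prop)
    (sim_def : forall i j : Omega,
        sim (member G i) (member G j) <-> S_isotopic (H i) (H j)) :
  Equivalence sim.
Proof.
split.
- move=> X; have [i ->] := family_set_memberP _ _ X.
  by apply/sim_def; exact: S_isotopic_refl.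
- move=> X Y.
  have [[i ->] [j ->]] := (family_set_memberP _ _ X, family_set_memberP _ _ Y).
  by move=> /sim_def ij; apply/sim_def; exact: S_isotopic_sym.
- move=> X Y Z; have [k ->] := family_set_memberP _ _ Z.
  have [[i ->] [j ->]] := (family_set_memberP _ _ X, family_set_memberP _ _ Y).
  move=> /sim_def ij /sim_def jk; apply/sim_def.
  exact: S_isotopic_trans ij jk.
Qed.
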